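(* For every $t<n$ there exists a protocol for $n$ processors solving binary Commit-Adopt against a mobile send-omission $t$-MAd adversary.
   Context: System: $n$ processors run a synchronous round-based protocol; each round every processor sends a (possibly different) message to every processor over dedicated point-to-point channels whose receiver knows the sender identity; messages of round $\rho$ are delivered by the start of round $\rho+1$. A message adversary (MAd) sees all messages; in the send-omission type it may delete any of the outgoing messages, in a given round, of the processors it corrupts in that round; it never alters internal states, inputs, outputs or incoming messages. A mobile $t$-MAd adversary corrupts at most $t$ processors in each round, possibly a different set each round. Every processor (corrupted or not) must output and the task conditions apply to all processors. Binary Commit-Adopt: each processor has an input bit and outputs $commit(v)$ or $adopt(v)$ with $v$ some processor's input; if all inputs equal $v$ all output $commit(v)$; if some processor outputs $commit(v)$ then every processor outputs $commit(v)$ or $adopt(v)$. *)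

(* Defs.v *)
From mathcomp Require Import all_boot.

Set Implicit Arguments.
Unset Strict Implicit.
Unset Printing Implicit Defensive.

(* Deterministic synchronous protocols for the processors 'I_n, with inputs in
   [I] and outputs in [O]. In [send p r s q], processor [p] in state [s] sends
   a message to [q] in round [r]; in [recv q r s m], [m p] is what arrived at
   [q] on the channel from [p], [None] if the message was deleted. A processor
   has output [o] once [output] of its state is [Some o]. *)
Record protocol (n : nat) (I O : Type) := Protocol {
  state : Type;
  message : Type;
  init : 'I_n -> I -> state;
  send : 'I_n -> nat -> state -> 'I_n -> message;
  recv : 'I_n -> nat -> state -> ('I_n -> option message) -> state;
  output : 'I_n -> state -> option O
}.

(* [m p q] is the message from [p] to [q]. *)
Definition round_messages (n : nat) (M : Type) := 'I_n -> 'I_n -> M.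

(* The adversary is adaptive: its choices for round [r] depend on the messages
   sent in rounds 0, ..., r, listed in this order and before any deletion. *)
Record adversary (n : nat) (M : Type) := Adversary {
  corrupted : seq (round_messages n M) -> {set 'I_n};
  deletes : seq (round_messages n M) -> 'I_n -> 'I_n -> bool
}.

Definition send_omission (n : nat) (M : Type) (A : adversary n M) : Prop :=
  forall h p q, deletes A h p q -> p \in corrupted A h.

(* The bound is per round, and the corrupted set may change between rounds. *)
Definition mobile (n : nat) (M : Type) (t : nat) (A : adversary n M) : Prop :=
  forall h, #|corrupted A h| <= t.

Section Execution.

Variables (n : nat) (I O : Type) (P : protocol n I O).
Variables (A : adversary n (message P)) (inp : 'I_n -> I).

(* The local states at the start of round [r], and the messages sent in the
   rounds before [r]. *)
Fixpoint execution (r : nat) :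
    ('I_n -> state P) * seq (round_messages n (message P)) :=
  if r is r'.+1 then
    let: (st, h) := execution r' in
    let sent p q := send p r' (st p) q in
    let h' := rcons h sent in
    (fun q => recv q r' (st q)
       (fun p => if deletes A h' p q then None else Some (sent p q)), h')
  else (fun p => init P p (inp p), [::]).

(* Outputs are irrevocable. *)
Definition outputs (p : 'I_n) (o : O) : Prop :=
  exists r, forall s,
    output p ((execution s).1 p) = if r <= s then Some o else None.

End Execution.

(* A task relates input assignments to allowed output assignments. *)
Definition solves (n : nat) (I O : Type)
    (task : ('I_n -> I) -> ('I_n -> O) -> Prop) (P : protocol n I O)
    (adv : adversary n (message P) -> Prop) : Prop :=
  forall (A : adversary n (message P)) (inp : 'I_n -> I), adv A ->
    exists out : 'I_n -> O,
      (forall p, outputs A inp p (out p)) /\ task inp out.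

Arguments solves {n I O} task P adv.

Inductive ca_output := Commit of bool | Adopt of bool.

Definition ca_value (o : ca_output) : bool :=
  match o with Commit v => v | Adopt v => v end.

Definition binary_commit_adopt (n : nat)
    (inp : 'I_n -> bool) (out : 'I_n -> ca_output) : Prop :=
  [/\ forall p, exists q, ca_value (out p) = inp q,
      forall v, (forall p, inp p = v) -> forall p, out p = Commit v
    & forall v p, out p = Commit v ->
        forall q, out q = Commit v \/ out q = Adopt v].

(* Main.v *)
(* As [t < n], in each round some processor, the source of the round, is
   uncorrupted and hence heard by all. In the first round everybody sends its
   input and proposes [v] if it hears only [v]; all proposals agree, being the
   input of the source. In the second round everybody sends its proposal (or
   the lack of one), commits [v] if it hears only proposals [v], and adopts [v]
   if it hears at least one. If somebody commits [v], the source of the second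
   round proposed [v], so everybody heard a proposal [v] and no other one. *)
Require Import Defs.
From mathcomp Require Import all_boot.

Set Implicit Arguments.
Unset Strict Implicit.
Unset Printing Implicit Defensive.

Section Rounds.

Variable n : nat.
Implicit Types (m : 'I_n -> option (option bool)) (v w : bool).

(* In a received message, [Some (Some v)] is the proposal [v], [Some None] the
   lack of a proposal, and [None] a deleted message. *)
Definition unanimous m : option bool :=
  [pick v | [forall p, (m p == None) || (m p == Some (Some v))]].

Definition heard m : option bool := [pick v | [exists p, m p == Some (Some v)]].

(** The fallback [b] will be the processor's own input, so that an output is some input even if no
    proposal arrives. *)
Definition decide (b : bool) m : ca_output :=
  if unanimous m is Some v then Commit v
  else Adopt (if heard m is Some v then v else b).

Definition delivered (del : 'I_n -> 'I_n -> bool) (x : 'I_n -> option bool)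
    (q p : 'I_n) : option (option bool) :=
  if del p q then None else Some (x p).

(** Total silence would pass the test of [unanimous] for both bits; the message from [s] leaves at
    most one candidate. *)
Lemma unanimous_heard m s x v :
  m s = Some x -> unanimous m = Some v -> x = Some v.
Proof.
rewrite /unanimous => ms; case: pickP => //= w /forallP/(_ s).
by rewrite ms => /eqP[->] [->].
Qed.

Lemma unanimous_const m s v : m s = Some (Some v) ->
  (forall p, m p = None \/ m p = Some (Some v)) -> unanimous m = Some v.
Proof.
move=> ms mv; rewrite /unanimous; case: pickP => [w /forallP/(_ s)|/(_ v)].
  by rewrite ms => /eqP[->].
by case/forallP => p; case: (mv p) => ->; rewrite !eqxx ?orbT.
Qed.

Lemma heard_sent m v : heard m = Some v -> exists p, m p = Some (Some v).
Proof.
by rewrite /heard; case: pickP => // w /existsP[p /eqP mp] [<-]; exists p.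
Qed.

Lemma heard_const m s v : m s = Some (Some v) ->
  (forall p w, m p = Some (Some w) -> w = v) -> heard m = Some v.
Proof.
move=> ms mv; rewrite /heard; case: pickP => [w /existsP[p /eqP /mv ->] //|].
by move=> /(_ v) /existsP[]; exists s; apply/eqP.
Qed.

Lemma delivered_sent del x q p y : delivered del x q p = Some y -> x p = y.
Proof. by rewrite /delivered; case: del => // -[]. Qed.

Lemma two_round_commit_adopt (inp : 'I_n -> bool) del0 del1 s0 s1 :
    (forall q, ~~ del0 s0 q) -> (forall q, ~~ del1 s1 q) ->
  let prop q := unanimous (delivered del0 (Some \o inp) q) in
  binary_commit_adopt inp (fun q => decide (inp q) (delivered del1 prop q)).
Proof.
move=> hs0 hs1 prop.
have src0 q : delivered del0 (Some \o inp) q s0 = Some (Some (inp s0)).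
  by rewrite /delivered (negPf (hs0 q)).
have src1 q : delivered del1 prop q s1 = Some (prop s1).
  by rewrite /delivered (negPf (hs1 q)).
have prop_src p v : prop p = Some v -> inp s0 = v.
  by move=> /(unanimous_heard (src0 p)) [].
have unan_prop q v :
    unanimous (delivered del1 prop q) = Some v -> prop s1 = Some v.
  exact: unanimous_heard (src1 q).
split.
- move=> q; rewrite /decide.
  case Eu: unanimous => [v|].
    by exists s0; rewrite (prop_src _ _ (unan_prop _ _ Eu)).
  case Eh: heard => [v|]; last by exists q.
  by have [p /delivered_sent /prop_src <-] := heard_sent Eh; exists s0.
- move=> v inpv q.
  have propv p : prop p = Some v.
    apply: (@unanimous_const _ s0); first by rewrite src0 inpv.
    by move=> p'; rewrite /delivered /= inpv; case: ifP; [left|right].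
  rewrite /decide (@unanimous_const _ s1 v) //; first by rewrite src1 propv.
  by move=> p; rewrite /delivered propv; case: ifP; [left|right].
- move=> v p; rewrite {1}/decide; case Eu: unanimous => [w|//] [Ew] q.
  have prop1 : prop s1 = Some v by rewrite -Ew; apply: unan_prop Eu.
  (* If [q] commits as well, its value is also the proposal of [s1]. *)
  rewrite /decide; case Eq: unanimous => [u|].
    by left; move/unan_prop: Eq; rewrite prop1 => -[->].
  right; rewrite (@heard_const _ s1 v) //; first by rewrite src1 prop1.
  move=> p' u /delivered_sent /prop_src <-.
  exact: prop_src prop1.
Qed.

(* The state is the input, the current proposal and the output. Sending the
   input is sending it as a proposal. *)
Definition commit_adopt_protocol : protocol n bool ca_output :=
  @Protocol n bool ca_output (bool * option bool * option ca_output)%type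
    (option bool)
    (fun _ b => (b, Some b, None))
    (fun _ _ st _ => st.1.2)
    (fun _ r st m =>
       match r with
       | 0 => (st.1.1, unanimous m, None)
       | 1 => (st.1, Some (decide st.1.1 m))
       | _ => st
       end)
    (fun _ st => st.2).

End Rounds.

Lemma mobile_source n M t (A : adversary n M) h : t < n ->
  send_omission A -> mobile t A -> exists s, forall q, ~~ deletes A h s q.
Proof.
move=> ltn omi mob.
have /set0Pn[s] : ~: corrupted A h != set0.
  by rewrite -card_gt0 cardsCs setCK card_ord subn_gt0 (leq_ltn_trans (mob h)).
by rewrite inE => sh; exists s => q; apply: contra sh; apply: omi.
Qed.

Theorem theorem5p1 (n t : nat) (ht : t < n) :
  exists P : protocol n bool ca_output,
    solves (@binary_commit_adopt n) P
      (fun A : adversary n (message P) => send_omission A /\ mobile t A).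
Proof.
exists (commit_adopt_protocol n) => A inp [omi mob].
(* Deletions in round [r] depend on a history that includes round [r], hence the indices 1 and 2. *)
have [s0 hs0] := mobile_source (execution A inp 1).2 ht omi mob.
have [s1 hs1] := mobile_source (execution A inp 2).2 ht omi mob.
eexists; split; last exact: two_round_commit_adopt hs0 hs1.
(* The output appears at the start of round 2; [recv] then keeps the state fixed. *)
move=> p; exists 2; case=> [|[|s]] //=.
by elim: s => //= s; case: (execution A inp s) => st h /=.
Qed.
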